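(* Fix an integer $d \ge 3$. Then $V_n$ converges in distribution as $n\to\infty$.
   Context: $\mathbb{T}_d$ is the infinite rooted $d$-ary tree (every vertex has exactly $d$ children), with root $\rho$. The height $|v|$ of a vertex is its distance from $\rho$; $v$ is even (odd) if $|v|$ is even (odd). $N(v)$ is the set of children of $v$. Each edge $e$ carries a cookie $X_e$, where the $X_e$ are i.i.d. uniform on $\{-1,+1\}$; for an edge between $v$ and its child $u$ we write $X_{uv}$. For $n\ge 0$ and vertices $v$ with $|v|\le 2n$, define $V_n(v)=0$ if $|v|=2n$, and for $|v|<2n$ recursively $$V_n(v)=\max\{X_{uv}+V_n(u): u\in N(v)\}\ (v \text{ even}),\qquad V_n(v)=\min\{X_{uv}+V_n(u): u\in N(v)\}\ (v\text{ odd}).$$ $V_n:=V_n(\rho)$ is the value of the $n$-round game. Convergence in distribution is to a (proper) integer-valued random variable. *)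

(* Defs.v *)
From HB Require Import structures.
From mathcomp Require Import all_boot all_order all_algebra.
From mathcomp Require Import all_classical all_reals all_analysis measurable_realfun.

Set Implicit Arguments.
Unset Strict Implicit.
Unset Printing Implicit Defensive.

Import Order.TTheory GRing.Theory Num.Theory.
Import numFieldNormedType.Exports.

Local Open Scope classical_set_scope.
Local Open Scope ring_scope.

(* A vertex of the infinite rooted d-ary tree is the word of the choices made
   on the way from the root [::] to it: its height is its size and its
   children are the words [rcons v i]. *)
Notation vertex d := (seq 'I_d).

Definition root_vertex (d : nat) : vertex d := [::].
Definition height (d : nat) (v : vertex d) : nat := size v.
Definition child (d : nat) (v : vertex d) (i : 'I_d) : vertex d := rcons v i.

(* [(v, i)] is the edge joining [v] to [child v i]. *)
Notation edge d := (vertex d * 'I_d)%type.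

(* Largest and smallest element of a nonempty sequence (0 on [::]). *)
Definition seq_max (R : realType) (s : seq R) : R :=
  \big[Num.max/head 0 s]_(y <- s) y.
Definition seq_min (R : realType) (s : seq R) : R :=
  \big[Num.min/head 0 s]_(y <- s) y.

(* Value of the game that starts at [v] and lasts [k] more moves, for the
   cookie configuration [x]. *)
Fixpoint value_rec (d : nat) (R : realType) (x : edge d -> R) (k : nat)
    (v : vertex d) : R :=
  if k is k'.+1 then
    (if odd (height v) then @seq_min R else @seq_max R)
      [seq x (v, i) + value_rec x k' (child v i) | i <- enum 'I_d]
  else 0.

(* V_n(v), meaningful for |v| <= 2n; the recursion equations are the lemmas
   [value_leaf], [value_even] and [value_odd]. *)
Definition value (d : nat) (R : realType) (x : edge d -> R) (n : nat)
    (v : vertex d) : R :=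
  value_rec x (2 * n - height v) v.

Lemma value_leaf d (R : realType) (x : edge d -> R) n v :
  height v = (2 * n)%N -> value x n v = 0.
Proof. by rewrite /value => ->; rewrite subnn. Qed.

Lemma value_step d (R : realType) (x : edge d -> R) n v :
  (height v < 2 * n)%N ->
  value x n v = (if odd (height v) then @seq_min R else @seq_max R)
    [seq x (v, i) + value x n (child v i) | i <- enum 'I_d].
Proof.
move=> hv; rewrite /value (_ : 2 * n - height v = (2 * n - (height v).+1).+1)%N.
  rewrite /=; congr (_ _); apply: eq_map => i.
  by rewrite /child /height size_rcons.
by rewrite subnS prednK// subn_gt0.
Qed.

Lemma value_even d (R : realType) (x : edge d -> R) n v :
  (height v < 2 * n)%N -> ~~ odd (height v) ->
  value x n v = seq_max [seq x (v, i) + value x n (child v i) | i <- enum 'I_d].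
Proof. by move=> /value_step -> /negbTE ->. Qed.

Lemma value_odd d (R : realType) (x : edge d -> R) n v :
  (height v < 2 * n)%N -> odd (height v) ->
  value x n v = seq_min [seq x (v, i) + value x n (child v i) | i <- enum 'I_d].
Proof. by move=> /value_step -> ->. Qed.

Lemma seq_maxP (R : realType) (s : seq R) :
  s != [::] -> seq_max s \in s /\ forall y, y \in s -> y <= seq_max s.
Proof.
case: s => // a s _; rewrite /seq_max; split.
  by rewrite big_seq; elim/big_ind: _ => [|y z ys zs|//];
     [exact: mem_head | case: leP].
by move=> y ys; exact: le_bigmax_seq.
Qed.

Lemma seq_minP (R : realType) (s : seq R) :
  s != [::] -> seq_min s \in s /\ forall y, y \in s -> seq_min s <= y.
Proof.
case: s => // a s _; rewrite /seq_min; split.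
  by rewrite big_seq; elim/big_ind: _ => [|y z ys zs|//];
     [exact: mem_head | case: leP].
by move=> y ys; exact: ge_bigmin_seq.
Qed.

Section random_game.
Context disp (T : measurableType disp) (R : realType) (P : probability T R).

(* Mutual independence: the product rule over every finite subfamily. *)
Definition mutually_independent (I : choiceType) (X : I -> {RV P >-> R}) : Prop :=
  forall (s : seq I) (B : I -> set R), uniq s ->
    (forall i, measurable (B i)) ->
    P (\bigcap_(i in [set` s]) X i @^-1` B i) =
    (\prod_(i <- s) P (X i @^-1` B i))%E.

Definition uniform_sign (Y : {RV P >-> R}) : Prop :=
  P (Y @^-1` [set 1]) = (2^-1)%:E /\ P (Y @^-1` [set -1]) = (2^-1)%:E.

Definition iid_uniform_signs (I : choiceType) (X : I -> {RV P >-> R}) : Prop :=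
  mutually_independent X /\ forall i, uniform_sign (X i).

Definition random_value (d : nat) (X : edge d -> {RV P >-> R}) (n : nat)
    (v : vertex d) : T -> R :=
  fun w => value (fun e => X e w) n v.

Lemma measurable_random_value d (X : edge d -> {RV P >-> R}) n v :
  measurable_fun [set: T] (random_value X n v).
Proof.
rewrite /random_value /value; move: (2 * n - height v)%N => k.
elim: k v => [|k IH] v; first exact: measurable_cst.
rewrite /=.
have mF i : measurable_fun setT
    (fun w => X (v, i) w + value_rec (fun e => X e w) k (child v i)).
  by apply: measurable_funD => //; exact: IH.
set F := fun w i => X (v, i) w + value_rec (fun e => X e w) k (child v i).
have hd (s : seq 'I_d) : measurable_fun setT (fun w => head 0 (map (F w) s)).
  by case: s => [|i s] //=; exact: mF.
case: (odd _); rewrite /seq_min /seq_max.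
- under eq_fun do rewrite big_map.
  suff H s1 s2 : measurable_fun setT
      (fun w => \big[Num.min/head 0 (map (F w) s1)]_(i <- s2) F w i).
    exact: H.
  elim: s2 => [|i s2 IHs].
    by under eq_fun do rewrite big_nil; exact: hd.
  under eq_fun do rewrite big_cons.
  by apply: measurable_minr => //; exact: mF.
- under eq_fun do rewrite big_map.
  suff H s1 s2 : measurable_fun setT
      (fun w => \big[Num.max/head 0 (map (F w) s1)]_(i <- s2) F w i).
    exact: H.
  elim: s2 => [|i s2 IHs].
    by under eq_fun do rewrite big_nil; exact: hd.
  under eq_fun do rewrite big_cons.
  by apply: measurable_maxr => //; exact: mF.
Qed.

HB.instance Definition _ d (X : edge d -> {RV P >-> R}) n v :=
  isMeasurableFun.Build _ _ _ _ (random_value X n v)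
    (measurable_random_value X n v).

(* V_n, the value at the root. *)
Definition game_value (d : nat) (X : edge d -> {RV P >-> R}) (n : nat) :
  {RV P >-> R} := random_value X n (root_vertex d).

End random_game.

(* Convergence of the distribution functions at every continuity point of the
   limiting one. *)
Definition cvg_in_distribution disp disp' (T : measurableType disp)
    (T' : measurableType disp') (R : realType) (P : probability T R)
    (P' : probability T' R) (Y : nat -> {RV P >-> R}) (Z : {RV P' >-> R}) : Prop :=
  forall r : R, {for r, continuous (cdf Z)} ->
    cdf (Y n) r @[n --> \oo] --> cdf Z r.

(* Main.v *)
Require Import Defs.
From HB Require Import structures.
From Stdlib Require Import ZArith.
From mathcomp Require Import all_boot all_order all_algebra.
From mathcomp Require Import all_classical all_reals all_analysis measurable_realfun.
From mathcomp Require Import zify ssrZ ring lra.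

Set Implicit Arguments.
Unset Strict Implicit.
Unset Printing Implicit Defensive.
Import Order.TTheory GRing.Theory Num.Theory.
Import numFieldNormedType.Exports.
Local Open Scope ring_scope.

(* Give the value of a vertex v the sign (-1)^|v|: both recursions then become
   "maximum over the children of a fair sign minus the signed value of the
   child".  The values two generations apart differ by even numbers, so with
   k moves left the law of the signed value is encoded by
   p_k(j) = P(value >= 2j), and independence of the subtrees gives
     p_{k+1}(j) = 1 - ((p_k(-j) + p_k(1-j)) / 2)^d,   p_0(j) = [j <= 0].
   For d >= 3 the interface between 1 and 0 is pinned: p_k stays in a region
   where this map contracts the sup norm with weights e at j <= -1, then 1 and W
   at j = 0 and 1, and o at j >= 2.  Indeed p_{k+1}(j) for j <= -1 is
   insensitive to its arguments, which are close to 0, and for j >= 2 it only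
   depends on the values of p_k at negative places.  So p_k converges uniformly,
   and the limit still tends to 1 at -oo and to 0 at +oo.
   For d >= 6 the region is given by p(1) <= 1/10.  For d = 3, 4, 5 the
   contraction only holds close to the fixed point (and barely so for d = 3,
   where the rate at the fixed point exceeds 0.97), and the orbit is followed by interval arithmetic
   on integers until it enters an invariant box around that point. *)

(** * Profiles and the contraction argument *)

(** In the factorisation of [x ^+ n - y ^+ n] the cofactor of [x - y] is a sum of [n] monomials,
    each at most [mu ^+ n.-1]. *)
Lemma expr_lipschitz (R : realFieldType) (n : nat) (mu x y : R) :
  0 <= x <= mu -> 0 <= y <= mu ->
  `|x ^+ n - y ^+ n| <= n%:R * mu ^+ n.-1 * `|x - y|.
Proof.
move=> /andP[x0 xmu] /andP[y0 ymu].
rewrite subrXX normrM mulrC ler_wpM2r// ger0_norm; last first.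
  by apply: sumr_ge0 => i _; rewrite mulr_ge0// exprn_ge0.
apply: le_trans (_ : \sum_(i < n) mu ^+ n.-1 <= _); last first.
  by rewrite sumr_const card_ord mulr_natl.
apply: ler_sum => i _; have -> : n.-1 = (n.-1 - i + i)%N by have := ltn_ord i; lia.
have -> : (n.-1 - i + i - i = n.-1 - i)%N by lia.
by rewrite exprD ler_pM ?exprn_ge0// lerXn2r// nnegrE (le_trans x0, le_trans y0).
Qed.

Definition half_round (R : realFieldType) (d : nat) (f : int -> R) (j : int) : R :=
  1 - ((f (- j) + f (1 - j)) / 2) ^+ d.

Definition profile (R : realFieldType) (d n : nat) : int -> R :=
  iter n (half_round d) (fun j => (j <= 0)%R%:R).

Definition cutoff (R : realFieldType) (f : int -> R) : Prop :=
  (forall j, 0 <= f j <= 1) /\ (forall i j, i <= j -> f j <= f i).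

Lemma cutoff_half_round (R : realFieldType) d (f : int -> R) :
  cutoff f -> cutoff (half_round d f).
Proof.
move=> [f01 fni]; split=> [j|i j ij].
  have := f01 (- j); have := f01 (1 - j) => /andP[a b] /andP[a' b'].
  have h0 : 0 <= (f (- j) + f (1 - j)) / 2 by lra.
  have h1 : (f (- j) + f (1 - j)) / 2 <= 1 by lra.
  have := exprn_ge0 d h0; have := exprn_ile1 d h0 h1.
  by rewrite /half_round; lra.
rewrite /half_round lerD2l lerN2 lerXn2r// ?nnegrE.
- by have := f01 (- i); have := f01 (1 - i); lra.
- by have := f01 (- j); have := f01 (1 - j); lra.
- have : f (- i) <= f (- j) by apply: fni; lia.
  have : f (1 - i) <= f (1 - j) by apply: fni; lia.
  lra.
Qed.

Lemma cutoff_profile (R : realFieldType) d n : cutoff (@profile R d n).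
Proof.
elim: n => [|n IH]; last exact: cutoff_half_round.
split=> [j|i j ij] /=; first by case: (j <= 0) => /=; lra.
by rewrite ler_nat; case: (leP j 0) => //= j0; rewrite (le_trans ij j0).
Qed.

(** A move exchanges the two ends and shifts them by at most one place. This supplies the tails of
    the limit law. *)
Lemma profile_support (R : realFieldType) d n (j : int) : (0 < d)%N ->
  (n%:Z < j -> profile R d n j = 0) /\ (j <= - n%:Z -> profile R d n j = 1).
Proof.
move=> d0; elim: n j => [|n IH] j /=.
  by split=> [|->//]; rewrite ltNge => /negbTE ->.
rewrite /half_round; split=> nj.
  rewrite (IH (- j)).2 ?(IH (1 - j)).2; [|lia..].
  by rewrite (_ : (1 + 1) / 2 = 1); [rewrite expr1n subrr|lra].
rewrite (IH (- j)).1 ?(IH (1 - j)).1; [|lia..].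
by rewrite addr0 mul0r expr0n gtn_eqF// subr0.
Qed.

(** [mu0], [mu1] and [nu] bound the averages that [half_round] raises to the power [d] at the places
    0, -1 and 1; they control its Lipschitz constants there. *)
Definition pinned (R : realFieldType) (mu0 mu1 nu : R) (f : int -> R) : Prop :=
  [/\ cutoff f, f 0 + f 1 <= 2 * mu0, f 1 + f 2 <= 2 * mu1 & f (- 1) + f 0 <= 2 * nu].

Definition weight (R : realFieldType) (e W o : R) (j : int) : R :=
  if j <= - 1 then e else if j == 0 then 1 else if j == 1 then W else o.

Lemma half_round_lipschitz (R : realFieldType) d (f g : int -> R) (j : int) (mu a b : R) :
  cutoff f -> cutoff g -> f (- j) + f (1 - j) <= 2 * mu -> g (- j) + g (1 - j) <= 2 * mu ->
  `|f (- j) - g (- j)| <= a -> `|f (1 - j) - g (1 - j)| <= b ->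
  `|half_round d f j - half_round d g j| <= d%:R / 2 * mu ^+ d.-1 * (a + b).
Proof.
move=> [f01 _] [g01 _] fmu gmu fga fgb.
have -> : half_round d f j - half_round d g j =
   ((g (- j) + g (1 - j)) / 2) ^+ d - ((f (- j) + f (1 - j)) / 2) ^+ d.
  by rewrite /half_round; ring.
have hf : 0 <= (f (- j) + f (1 - j)) / 2 <= mu.
  by have := f01 (- j); have := f01 (1 - j); lra.
have hg : 0 <= (g (- j) + g (1 - j)) / 2 <= mu.
  by have := g01 (- j); have := g01 (1 - j); lra.
apply: le_trans (expr_lipschitz d hg hf) _.
have -> : d%:R / 2 * mu ^+ d.-1 * (a + b) = d%:R * mu ^+ d.-1 * ((a + b) / 2) by field.
rewrite ler_wpM2l// ?mulr_ge0// ?exprn_ge0//; first by lra.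
move: fga fgb; rewrite !ler_norml; lra.
Qed.

(** The last four inequalities say that the weighted Lipschitz constant is at most [lam] at j = 0, j
    = 1, j <= -1 and j >= 2 respectively. *)
Definition contracting (R : realFieldType) (d : nat) (mu0 mu1 nu e W o lam : R) : Prop :=
  [/\ 0 < e, e <= 1, e <= o, o <= W &
   [/\ d%:R / 2 * mu0 ^+ d.-1 * (1 + W) <= lam,
       d%:R / 2 * nu ^+ d.-1 * (e + 1) <= lam * W,
       d%:R / 2 * mu1 ^+ d.-1 * (W + o) <= lam * e &
       d%:R * e <= lam * o]].

Lemma weight_le_N1 (R : realFieldType) (e W o : R) j : j <= -1 -> weight e W o j = e.
Proof. by rewrite /weight => ->. Qed.

Lemma weight_ge2 (R : realFieldType) (e W o : R) j : 2 <= j -> weight e W o j = o.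
Proof.
move=> j2; rewrite /weight.
have -> : (j <= -1) = false by lia.
have -> : (j == 0) = false by lia.
by have -> : (j == 1) = false by lia.
Qed.

Lemma half_round_contraction (R : realFieldType) d (mu0 mu1 nu e W o lam : R)
    (f g : int -> R) (K : R) (w := weight e W o) :
  contracting d mu0 mu1 nu e W o lam ->
  pinned mu0 mu1 nu f -> pinned mu0 mu1 nu g ->
  (forall j, `|f j - g j| <= K * w j) ->
  forall j, `|half_round d f j - half_round d g j| <= lam * K * w j.
Proof.
move=> [e0 e1 eo oW [c0 c1 c2 c3]] [cf f0 f1 fn] [cg g0 g1 gn] fg j.
have K0 : 0 <= K.
  have := le_trans (normr_ge0 _) (fg (-1)).
  by rewrite /w /weight /= pmulr_lge0.
have fgw i k : w i = k -> `|f i - g i| <= K * k by move=> <-.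
have [[f01 fni] [g01 gni]] := (cf, cg).
have lipK mu a b : f (- j) + f (1 - j) <= 2 * mu -> g (- j) + g (1 - j) <= 2 * mu ->
   w (- j) = a -> w (1 - j) = b ->
   `|half_round d f j - half_round d g j| <= K * (d%:R / 2 * mu ^+ d.-1 * (a + b)).
  move=> fm gm /fgw wa /fgw wb.
  by apply: le_trans (half_round_lipschitz d cf cg fm gm wa wb) _; rewrite -mulrDr; lra.
(* It remains to choose, for each place [j], a bound [mu] on the averages and to read off the
   weights of the two arguments. *)
suff [mu [a [b [? ? ? ? ab]]]] : exists mu a b,
    [/\ f (- j) + f (1 - j) <= 2 * mu, g (- j) + g (1 - j) <= 2 * mu,
        w (- j) = a, w (1 - j) = b & d%:R / 2 * mu ^+ d.-1 * (a + b) <= lam * w j].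
  apply: le_trans (_ : K * (d%:R / 2 * mu ^+ d.-1 * (a + b)) <= _); first exact: lipK.
  by rewrite [leRHS](_ : _ = K * (lam * w j)) ?ler_wpM2l//; ring.
have mu10 : 0 <= mu1 by have := f01 1; have := f01 2; lra.
have [j2|j2] := lerP 2 j.
  (* Both arguments are at most -1, where only the trivial bound 1 is at hand; the small weight [e]
     compensates for it. *)
  exists 1, e, e; split.
  - by have := f01 (- j); have := f01 (1 - j); lra.
  - by have := g01 (- j); have := g01 (1 - j); lra.
  - by apply: weight_le_N1; clear -j2; lia.
  - by apply: weight_le_N1; clear -j2; lia.
  - have -> : w j = o by apply: weight_ge2; clear -j2; lia.
    by rewrite expr1n mulr1 (_ : _ * (e + e) = d%:R * e) //; field.
have [->|j1] := eqVneq j 1.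
  by exists nu, e, 1; split=> //; rewrite subrr.
have [->|j0] := eqVneq j 0.
  by exists mu0, 1, W; split; rewrite ?oppr0 ?subr0// /w /weight/= mulr1.
have [->|jN1] := eqVneq j (- 1).
  by exists mu1, W, o; split; rewrite ?opprK.
(* Now [j <= -2]: both arguments are at least 2, so by monotonicity [mu1] still bounds the averages,
   and [o + o <= W + o]. *)
exists mu1, o, o; split.
- have : f (- j) <= f 2 by apply: fni; clear -j2 j1 j0 jN1; lia.
  have : f (1 - j) <= f 2 by apply: fni; clear -j2 j1 j0 jN1; lia.
  have : f 2 <= f 1 by apply: fni.
  lra.
- have : g (- j) <= g 2 by apply: gni; clear -j2 j1 j0 jN1; lia.
  have : g (1 - j) <= g 2 by apply: gni; clear -j2 j1 j0 jN1; lia.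
  have : g 2 <= g 1 by apply: gni.
  lra.
- by apply: weight_ge2; clear -j2 j1 j0 jN1; lia.
- by apply: weight_ge2; clear -j2 j1 j0 jN1; lia.
- have -> : w j = e by apply: weight_le_N1; clear -j2 j1 j0 jN1; lia.
  by apply: le_trans c2; rewrite ler_wpM2l ?lerD2r// mulr_ge0 ?exprn_ge0.
Qed.

Lemma profile_cauchy (R : realFieldType) d (mu0 mu1 nu e W o lam : R) N :
  contracting d mu0 mu1 nu e W o lam -> 0 <= lam -> lam < 1 ->
  (forall n, (N <= n)%N -> pinned mu0 mu1 nu (profile R d n)) ->
  exists C, forall k m j,
    `|profile R d (N + k + m) j - profile R d (N + k) j| <= C * lam ^+ k.
Proof.
move=> ctr lam0 lam1 pin.
have [e0 e1 eo oW _] := ctr; pose w := weight e W o.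
have we j : e <= w j by rewrite /w /weight; do 3?case: ifP => _; lra.
have wm j : w j <= 1 + W by rewrite /w /weight; do 3?case: ifP => _; lra.
(* Since [e] is the least weight, the trivial bound 1 on the first difference becomes the weighted
   bound [w j / e]. *)
have step k j : `|profile R d (N + k.+1) j - profile R d (N + k) j| <=
    lam ^+ k / e * w j.
  elim: k j => [|k IH] j.
    have [p01 _] := @cutoff_profile R d (N + 1).
    have [q01 _] := @cutoff_profile R d (N + 0).
    apply: (@le_trans _ _ 1).
      by rewrite ler_norml; have := p01 j; have := q01 j; lra.
    by rewrite expr0 mul1r mulrC ler_pdivlMr// mul1r.
  rewrite (addnS N k.+1) [X in _ - X](_ : _ = half_round d (profile R d (N + k)) j).
    rewrite exprS -(mulrA lam).
    apply: (half_round_contraction ctr) => //; apply: pin; clear; lia.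
  by rewrite addnS.
pose B := (1 + W) / e.
have B0 : 0 <= B by rewrite divr_ge0//; lra.
have stepB k j : `|profile R d (N + k.+1) j - profile R d (N + k) j| <= B * lam ^+ k.
  apply: le_trans (step k j) _.
  rewrite [leRHS](_ : _ = lam ^+ k / e * (1 + W)); last by rewrite /B; ring.
  by rewrite ler_wpM2l// divr_ge0 ?exprn_ge0// ltW.
exists (B / (1 - lam)) => k m j.
(* The exact partial sum of the geometric series is kept, so that the induction on [m] closes. *)
apply: le_trans (_ : B / (1 - lam) * (lam ^+ k - lam ^+ (k + m)) <= _); last first.
  have lam1' : 0 <= 1 - lam by lra.
  by rewrite ler_wpM2l ?(divr_ge0 B0 lam1')// gerBl exprn_ge0.
elim: m => [|m IH]; first by rewrite !addn0 !subrr normr0 mulr0.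
rewrite -(subrKA (profile R d (N + k + m) j)).
apply: le_trans (ler_normD _ _) _.
have -> : B / (1 - lam) * (lam ^+ k - lam ^+ (k + m.+1)) =
  B * lam ^+ (k + m) + B / (1 - lam) * (lam ^+ k - lam ^+ (k + m)).
  by rewrite addnS exprS; field; lra.
by rewrite lerD// -!addnA addnS; exact: stepB.
Qed.

(** * Interval arithmetic for d = 3, 4, 5 *)

Definition scale : Z := 100000000.

(* Bounds, multiplied by [scale], on a profile at the places -2, -1, 0, 1, 2
   from below and -1, 0, 1, 2, 3 from above. *)
Record bracket := Bracket {
  lo_2 : Z; lo_1 : Z; lo0 : Z; lo1 : Z; lo2 : Z;
  hi_1 : Z; hi0 : Z; hi1 : Z; hi2 : Z; hi3 : Z }.

Section integer_arithmetic.
Local Open Scope Z_scope.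

Definition zpow (s : Z) (d : nat) : Z := ssrnat.iter d (Z.mul s) 1.

(** If [s] stands for the sum [s / scale] of two values, then [scale] times the [d]-th power of its
    half is [s ^ d] over this number. *)
Definition step_scale (d : nat) : Z := zpow 2 d * zpow scale d.-1.

(** Division on [Z] rounds down; the [+ 1] makes the subtracted term an upper bound. *)
Definition step_down (d : nat) (s : Z) : Z :=
  scale - (zpow s d / step_scale d + 1).

(* Lower bounds may be slightly negative, hence the [Z.max]. *)
Definition step_up (d : nat) (s : Z) : Z := scale - zpow (Z.max 0 s) d / step_scale d.

(* Outside the window one uses f (- 2) <= 1 for the fifth bound from below and
   f (- 3) >= f (- 2) for the fifth bound from above. *)
Definition bracket_step (d : nat) (B : bracket) : bracket :=
  let: Bracket l_2 l_1 l0 l1 l2 u_1 u0 u1 u2 u3 := B in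
  Bracket
    (step_down d (u2 + u3)) (step_down d (u1 + u2)) (step_down d (u0 + u1))
    (step_down d (u_1 + u0)) (step_down d (scale + u_1))
    (step_up d (l1 + l2)) (step_up d (l0 + l1)) (step_up d (l_1 + l0))
    (step_up d (l_2 + l_1)) (step_up d (l_2 + l_2)).

Definition bracket_sub (A B : bracket) : bool :=
  let: Bracket l_2 l_1 l0 l1 l2 u_1 u0 u1 u2 u3 := A in
  let: Bracket l_2' l_1' l0' l1' l2' u_1' u0' u1' u2' u3' := B in
  [&& l_2' <=? l_2, l_1' <=? l_1, l0' <=? l0, l1' <=? l1, l2' <=? l2,
      u_1 <=? u_1', u0 <=? u0', u1 <=? u1', u2 <=? u2' & u3 <=? u3'].

Definition bracket0 : bracket := Bracket scale scale scale 0 0 scale scale 0 0 0.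

(* [contracting] for the parameters divided by [scale], denominators cleared. *)
Definition contractingZ (d : nat) (m0 m1 nu e W o lam : Z) : bool :=
  let D := Z.of_nat d in let K := zpow scale d.-1 in
  [&& 0 <? e, e <=? scale, e <=? o, o <=? W &
  [&& D * zpow m0 d.-1 * (scale + W) <=? 2 * lam * K,
      D * zpow nu d.-1 * (e + scale) * scale <=? 2 * lam * W * K,
      D * zpow m1 d.-1 * (W + o) * scale <=? 2 * lam * e * K &
      D * e * scale <=? lam * o]].

(** The two inclusions place the orbit in [B] after [N] moves and keep it there; the last three
    inequalities make every profile bracketed by [B] pinned. *)
Definition certificate (d N : nat) (B : bracket) (m0 m1 nu e W o lam : Z) : bool :=
  [&& contractingZ d m0 m1 nu e W o lam, (0 <=? lam) && (lam <? scale),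
      bracket_sub (ssrnat.iter N (bracket_step d) bracket0) B,
      bracket_sub (bracket_step d B) B &
      [&& hi0 B + hi1 B <=? 2 * m0, hi1 B + hi2 B <=? 2 * m1 &
          hi_1 B + hi0 B <=? 2 * nu]].

End integer_arithmetic.

(* The brackets surround the numerical fixed point, with half-widths
   proportional to the weights. *)
Lemma certificate3 : certificate 3 210
  (Bracket 99999950 99881500 85025800 20708600 166400 99886500 85225900 20975700 181500 153)
  53100801 10578601 92556201 2450000 133500000 7500000 99000000.
Proof. by vm_compute. Qed.

Lemma certificate4 : certificate 4 210
  (Bracket 99999990 99995600 91419300 14979200 3700 99997100 92019400 16155300 11000 43)
  54087351 8083151 96008251 240000 196000000 1200000 94000000.
Proof. by vm_compute. Qed.

Lemma certificate5 : certificate 5 210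
  (Bracket 99999990 99999800 95458900 8732700 (-10) 100000000 96259000 11132800 1100 53)
  53695901 5566951 98129501 40000 300000000 250000 85000000.
Proof. by vm_compute. Qed.

(* Locked: unfolding [zR scale] would produce a unary numeral. *)
HB.lock Definition zR (R : realFieldType) (z : Z) : R := (int_of_Z z)%:~R.

Lemma zRD (R : realFieldType) a b : zR R (Z.add a b) = zR R a + zR R b.
Proof. by rewrite !unlock -intrD; congr (_%:~R); lia. Qed.

Lemma zRB (R : realFieldType) a b : zR R (Z.sub a b) = zR R a - zR R b.
Proof. by rewrite !unlock -intrB; congr (_%:~R); lia. Qed.

Lemma zRM (R : realFieldType) a b : zR R (Z.mul a b) = zR R a * zR R b.
Proof. by rewrite !unlock -intrM; congr (_%:~R); lia. Qed.

Lemma zR_nat (R : realFieldType) n : zR R (Z.of_nat n) = n%:R.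
Proof. by rewrite !unlock pmulrn; congr (_%:~R); lia. Qed.

Lemma zRX (R : realFieldType) a n : zR R (zpow a n) = zR R a ^+ n.
Proof.
elim: n => [|n IH]; first by rewrite expr0 unlock.
by rewrite exprS -IH -zRM.
Qed.

Lemma zR_le (R : realFieldType) a b : Z.leb a b -> zR R a <= zR R b.
Proof. by rewrite !unlock ler_int; lia. Qed.

Lemma zR_lt (R : realFieldType) a b : Z.ltb a b -> zR R a < zR R b.
Proof. by rewrite !unlock ltr_int; lia. Qed.

Lemma zR0 (R : realFieldType) : zR R Z0 = 0.
Proof. by rewrite unlock. Qed.

Lemma zR2 (R : realFieldType) : zR R 2 = 2.
Proof. by rewrite unlock -pmulrn. Qed.

Lemma zpow_gt0 a n : Z.lt Z0 a -> Z.lt Z0 (zpow a n).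
Proof. by move=> a0; elim: n => //= n IH; apply: Z.mul_pos_pos. Qed.

Lemma step_scale_gt0 d : Z.lt Z0 (step_scale d).
Proof. by apply: Z.mul_pos_pos; exact: zpow_gt0. Qed.

Lemma zR_scale_gt0 (R : realFieldType) : 0 < zR R scale.
Proof. by rewrite -zR0; apply: zR_lt; vm_compute. Qed.

Lemma zR_step_scale (R : realFieldType) d : (0 < d)%N ->
  zR R scale * zR R (step_scale d) = (2 * zR R scale) ^+ d.
Proof.
by move=> d0; rewrite /step_scale zRM !zRX zR2 mulrCA -exprS prednK// exprMn.
Qed.

Lemma step_down_le (R : realFieldType) d s (x : R) : (0 < d)%N -> 0 <= x ->
  zR R scale * x <= zR R s ->
  zR R (step_down d s) <= zR R scale * (1 - (x / 2) ^+ d).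
Proof.
move=> d0 x0 xs; have M0 := zR_scale_gt0 R.
have K0 := step_scale_gt0 d.
have /(zR_lt R) : Z.ltb (zpow s d) (Z.mul (step_scale d) (Z.div (zpow s d) (step_scale d) + 1)).
  by apply/Z.ltb_lt/Z.mul_succ_div_gt.
rewrite /step_down zRB zRM !zRX; set q := zR R (Z.add _ _) => h.
suff : zR R scale * (x / 2) ^+ d <= q by rewrite mulrBr mulr1; lra.
have KR0 : 0 < zR R (step_scale d) by rewrite -zR0; apply: zR_lt; apply/Z.ltb_lt.
rewrite -(ler_pM2l KR0) mulrA [_ * zR R scale]mulrC zR_step_scale// -exprMn.
apply: le_trans (ltW h); rewrite (_ : 2 * _ * _ = zR R scale * x); last by field.
have Mx0 : 0 <= zR R scale * x := mulr_ge0 (ltW M0) x0.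
by rewrite lerXn2r// nnegrE (le_trans Mx0 xs).
Qed.

Lemma step_up_ge (R : realFieldType) d s (x : R) : (0 < d)%N -> 0 <= x ->
  zR R s <= zR R scale * x ->
  zR R scale * (1 - (x / 2) ^+ d) <= zR R (step_up d s).
Proof.
move=> d0 x0 sx; have M0 := zR_scale_gt0 R.
have K0 := step_scale_gt0 d.
(* Truncation at 0 keeps a lower bound of [scale * x], because [x] is nonnegative. *)
have h0 : 0 <= zR R (Z.max 0 s) by rewrite -zR0; apply: zR_le; lia.
have hx : zR R (Z.max 0 s) <= zR R scale * x.
  by case: (Z.max_spec 0 s) => -[_ ->] //; rewrite zR0 mulr_ge0// ltW.
rewrite /step_up; move: (Z.max 0 s) h0 hx => t t0 tx.
have /(zR_le R) : Z.leb (Z.mul (step_scale d) (Z.div (zpow t d) (step_scale d))) (zpow t d).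
  by apply/Z.leb_le/Z.mul_div_le.
rewrite zRB zRM !zRX; set q := zR R (Z.div _ _) => h.
suff : q <= zR R scale * (x / 2) ^+ d by rewrite mulrBr mulr1; lra.
have KR0 : 0 < zR R (step_scale d) by rewrite -zR0; apply: zR_lt; apply/Z.ltb_lt.
rewrite -(ler_pM2l KR0) mulrA [_ * zR R scale]mulrC zR_step_scale// -exprMn.
apply: le_trans h _; rewrite (_ : 2 * _ * _ = zR R scale * x); last by field.
by rewrite lerXn2r// nnegrE (mulr_ge0 (ltW M0) x0).
Qed.

Definition bracketed (R : realFieldType) (B : bracket) (f : int -> R) : Prop :=
  let: Bracket l_2 l_1 l0 l1 l2 u_1 u0 u1 u2 u3 := B in
  let M := zR R scale in
  [/\ zR R l_2 <= M * f (- 2), zR R l_1 <= M * f (- 1), zR R l0 <= M * f 0,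
      zR R l1 <= M * f 1 & zR R l2 <= M * f 2] /\
  [/\ M * f (- 1) <= zR R u_1, M * f 0 <= zR R u0, M * f 1 <= zR R u1,
      M * f 2 <= zR R u2 & M * f 3 <= zR R u3].

Lemma bracketed_sub (R : realFieldType) A B (f : int -> R) :
  bracket_sub A B -> bracketed A f -> bracketed B f.
Proof.
case: A => ? ? ? ? ? ? ? ? ? ?; case: B => ? ? ? ? ? ? ? ? ? ? /=.
do 9![move=> /andP[/(zR_le R) ?]]; move=> /(zR_le R) ? [[? ? ? ? ?] [? ? ? ? ?]].
by split; split; lra.
Qed.

(** [half_round] is order-reversing on nonnegative profiles, so upper bounds produce lower bounds
    and conversely. *)
Lemma bracketed_step (R : realFieldType) d B (f : int -> R) : (0 < d)%N ->
  cutoff f -> bracketed B f -> bracketed (bracket_step d B) (half_round d f).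
Proof.
move=> d0 [f01 fni]; have M0 := zR_scale_gt0 R.
have f0 j : 0 <= f j by case/andP: (f01 j).
have f1 j : f j <= 1 by case/andP: (f01 j).
case: B => l_2 l_1 l0 l1 l2 u_1 u0 u1 u2 u3.
move=> [[? ? ? ? ?] [? ? ? ? ?]]; have M2 : zR R scale * f (- 3) >= zR R l_2.
  apply: le_trans (_ : zR R scale * f (- 2) <= _) => //.
  by rewrite (ler_wpM2l (ltW M0))// fni.
have M3 : zR R scale * f (- 2) <= zR R scale by rewrite (ler_piMr (ltW M0)).
split; split; rewrite /half_round;
  (apply: step_down_le || apply: step_up_ge) => //;
  rewrite ?addr_ge0// zRD mulrDr ?opprK; exact: lerD.
Qed.

Lemma bracketed0 (R : realFieldType) d : bracketed bracket0 (profile R d 0).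
Proof. by rewrite /bracketed /= zR0 !mulr0 !mulr1. Qed.

Lemma certificate_bracketed (R : realFieldType) d N B m0 m1 nu e W o lam n :
  (0 < d)%N -> certificate d N B m0 m1 nu e W o lam -> (N <= n)%N ->
  bracketed B (profile R d n).
Proof.
move=> d0 /and5P[_ _ startB stepB _] /subnKC <-.
elim: (n - N)%N => [|k IH].
  rewrite addn0; apply: bracketed_sub startB _.
  elim: N => [|N IH]; first exact: bracketed0.
  by apply: bracketed_step => //; exact: cutoff_profile.
rewrite addnS; apply: bracketed_sub stepB _.
by apply: bracketed_step => //; exact: cutoff_profile.
Qed.

Lemma contractingZ_contracting (R : realFieldType) d m0 m1 nu e W o lam
    (r := fun z => zR R z / zR R scale) :
  contractingZ d m0 m1 nu e W o lam ->
  contracting d (r m0) (r m1) (r nu) (r e) (r W) (r o) (r lam).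
Proof.
have M0 := zR_scale_gt0 R; have M1 := lt0r_neq0 M0.
move=> /and5P[/(zR_lt R) e0 /(zR_le R) e1 /(zR_le R) eo /(zR_le R) oW].
move=> /and4P[/(zR_le R) c0 /(zR_le R) c1 /(zR_le R) c2 /(zR_le R) c3].
rewrite zR0 in e0; move: c0 c1 c2 c3.
rewrite !zRM !zRD !zRX zR2 zR_nat {}/r => c0 c1 c2 c3.
have K0 := exprn_gt0 d.-1 M0.
move: (zR R scale) (zR R m0) (zR R m1) (zR R nu) (zR R e) (zR R W) (zR R o) (zR R lam)
  M0 M1 K0 e0 e1 eo oW c0 c1 c2 c3 => M a b c E w O L M0 M1 K0 e0 e1 eo oW c0 c1 c2 c3.
have K1 := lt0r_neq0 K0.
have le_frac (x y z t : R) : 0 < z -> x = y / z -> y <= t * z -> x <= t.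
  by move=> z0 -> h; rewrite ler_pdivrMr.
split; [exact: divr_gt0 | by rewrite ler_pdivrMr ?mul1r | by rewrite ler_pM2r ?invr_gt0
  | by rewrite ler_pM2r ?invr_gt0 |].
split; rewrite ?expr_div_n.
- apply: (le_frac _ (d%:R * a ^+ d.-1 * (M + w)) (2 * (M ^+ d.-1 * M))).
  + by rewrite !mulr_gt0.
  + by field; rewrite M1 K1.
  + by rewrite [leRHS](_ : _ = 2 * L * M ^+ d.-1)//; field.
- apply: (le_frac _ (d%:R * c ^+ d.-1 * (E + M) * M) (2 * (M ^+ d.-1 * M * M))).
  + by rewrite !mulr_gt0.
  + by field; rewrite M1 K1.
  + by rewrite [leRHS](_ : _ = 2 * L * w * M ^+ d.-1)//; field.
- apply: (le_frac _ (d%:R * b ^+ d.-1 * (w + O) * M) (2 * (M ^+ d.-1 * M * M))).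
  + by rewrite !mulr_gt0.
  + by field; rewrite M1 K1.
  + by rewrite [leRHS](_ : _ = 2 * L * E * M ^+ d.-1)//; field.
- apply: (le_frac _ (d%:R * E * M) (M * M)).
  + by rewrite mulr_gt0.
  + by field.
  + by rewrite [leRHS](_ : _ = L * O)//; field.
Qed.

Definition uniformly_cauchy (R : realFieldType) d : Prop :=
  exists (N : nat) (C lam : R), [/\ 0 <= lam, lam < 1 & forall k m j,
    `|profile R d (N + k + m) j - profile R d (N + k) j| <= C * lam ^+ k].

Lemma certificate_uniformly_cauchy (R : realFieldType) d N B m0 m1 nu e W o lam :
  (0 < d)%N -> certificate d N B m0 m1 nu e W o lam -> uniformly_cauchy R d.
Proof.
move=> d0 cert; have M0 := zR_scale_gt0 R.
have := certificate_bracketed R d0 cert.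
case/and5P: cert => /(contractingZ_contracting R) ctr /andP[/(zR_le R) l0 /(zR_lt R) l1] _ _.
move=> /and3P[/(zR_le R) h0 /(zR_le R) h1 /(zR_le R) h2] Bf.
rewrite zR0 in l0.
have [|||C hC] := profile_cauchy (N := N) ctr; first by rewrite divr_ge0// ltW.
- by rewrite ltr_pdivrMr ?mul1r.
- move=> n /Bf; have cf := cutoff_profile R d n.
  move: h0 h1 h2; rewrite !zRD !zRM zR2.
  case: B {Bf} => ? ? ? ? ? ? ? ? ? ? /= h0 h1 h2 [[? ? ? ? ?] [? ? ? ? ?]].
  by split=> //; rewrite mulrA ler_pdivlMr// mulrC mulrDr; lra.
- exists N, C, (zR R lam / zR R scale); split=> //; first by rewrite divr_ge0// ltW.
  by rewrite ltr_pdivrMr ?mul1r.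
Qed.

(** * Large d and the limiting profile *)

(** [P k * a ^+ (m + k)] is nonincreasing in [k]. This reduces inequalities for all [d >= 6],
    polynomial in [d] times a power, to [d = 6]. *)
Lemma geometric_decay (R : realFieldType) (a : R) (P : nat -> R) m k :
  0 <= a -> (forall i, a * P i.+1 <= P i) -> P k * a ^+ (m + k) <= P 0%N * a ^+ m.
Proof.
move=> a0 aP; elim: k => [|k IH]; first by rewrite addn0.
apply: le_trans IH; rewrite addnS exprS mulrA ler_wpM2r ?exprn_ge0//.
by rewrite mulrC.
Qed.

(** Bernoulli's inequality, as the Lipschitz bound between [1] and [1 - x]. *)
Lemma expr_1B_ge (R : realFieldType) (x : R) n : 0 <= x <= 1 -> 1 - n%:R * x <= (1 - x) ^+ n.
Proof.
move=> x01; have x01' : 0 <= 1 - x <= 1 by lra.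
have x0 : 0 <= x by case/andP: x01.
have := @expr_lipschitz R n 1 1 (1 - x); rewrite !expr1n mulr1 ler01 lexx.
move=> /(_ isT x01'); have -> : 1 - (1 - x) = x by ring.
by rewrite (ger0_norm x0) ler_norml; lra.
Qed.

(* The bound propagates over two applications of [half_round], not over one. *)
Lemma profile1_le_tenth (R : realFieldType) k n : profile R (k + 6) n 1 <= 1 / 10.
Proof.
set d := (k + 6)%N.
(* If [f 1 <= 1/10], the averages at 0 and -1 are at most (1 + 1/10)/2 = 11/20 and 1/10. By
   Bernoulli, two moves bring the value at 1 below half of this left-hand side. *)
have decay : d%:R * ((11 / 20) ^+ d + (1 / 10) ^+ d) <= 1 / 5 :> R.
  have dE : d%:R = k%:R + 6 :> R by rewrite /d natrD.
  (* 6/7 is the largest [a] with [a * (i + 7) <= i + 6] for all [i]. *)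
  have H (a : R) : 0 <= a <= 6 / 7 -> d%:R * a ^+ d <= 6 * a ^+ 6.
    move=> a01; rewrite /d addnC; have := @geometric_decay R a (fun i => i%:R + 6) 6 k.
    rewrite natrD [_ + k%:R]addrC add0r; apply; first by lra.
    move=> i; rewrite -natr1; have i0 : 0 <= i%:R :> R by [].
    have : a * (i%:R + 7) <= 6 / 7 * (i%:R + 7) by rewrite ler_wpM2r; lra.
    lra.
  have := H (11 / 20); have := H (1 / 10); rewrite mulrDr.
  lra.
have [n2] := ubnP n; elim: n2 n => // n2 IH [|[|n]] nn2 /=; first by lra.
  rewrite /half_round /=.
  have -> : (1 + 1) / 2 = 1 :> R by field.
  by rewrite expr1n; lra.
have {}IH := IH n ltac:(lia).
have [f01 fni] := cutoff_profile R d n.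
move: (profile R d n) IH f01 fni => f f1 f01 fni.
have pow (x y : R) : 0 <= x <= y -> x ^+ d <= y ^+ d.
  by move=> /andP[x0 xy]; rewrite lerXn2r// nnegrE (le_trans x0).
have f2 : f 2 <= f 1 by apply: fni.
have g0 : 1 - (11 / 20) ^+ d <= half_round d f 0.
  by rewrite lerD2l lerN2 pow// oppr0 subr0; have := f01 0; have := f01 1; lra.
have gN1 : 1 - (1 / 10) ^+ d <= half_round d f (- 1).
  by rewrite lerD2l lerN2 pow// !opprK; have := f01 1; have := f01 (1 + 1); lra.
pose z : R := ((11 / 20) ^+ d + (1 / 10) ^+ d) / 2.
have unit (x : R) : 0 <= x -> x <= 1 -> 0 <= x ^+ d <= 1.
  by move=> x0 x1; rewrite exprn_ge0 ?exprn_ile1.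
have /andP[a0 a1] := unit (11 / 20) ltac:(lra) ltac:(lra).
have /andP[b0 b1] := unit (1 / 10) ltac:(lra) ltac:(lra).
have z01 : 0 <= z <= 1 by rewrite /z; lra.
have := expr_1B_ge d z01.
have : (1 - z) ^+ d <= ((half_round d f (- 1) + half_round d f (1 - 1)) / 2) ^+ d.
  by rewrite subrr; apply: pow; rewrite /z; lra.
rewrite [in X in _ -> _ -> X <= _]/half_round.
have -> : d%:R * z = d%:R * ((11 / 20) ^+ d + (1 / 10) ^+ d) / 2 by rewrite /z mulrA.
lra.
Qed.

(** With only the trivial bound [nu = 1] at place 1, the weight [W] has to grow linearly in [d]. The
    powers of 11/20 and 1/10 absorb the resulting quadratic factors. *)
Lemma contracting_large (R : realFieldType) k (d := (k + 6)%N) :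
  contracting d (11 / 20) (1 / 10) 1 (3 / 50) (2 * d%:R / 3) (2 * d%:R / 3) (4 / 5 : R).
Proof.
have dE : d%:R = k%:R + 6 :> R by rewrite /d natrD.
have k0 : 0 <= k%:R :> R by [].
have dE1 : d.-1 = (5 + k)%N by rewrite /d addnC.
split; [lra.. | split].
(* For d = i + 6 the polynomial is d (2d + 3) = 3 d (1 + W). *)
- have := @geometric_decay R (11 / 20) (fun i => (i%:R + 6) * (2 * i%:R + 15)) 5 k.
  rewrite dE1 dE mulr0 !add0r => H.
  have {}H := H ltac:(lra) _.
  suff /H : forall i, 11 / 20 * ((i.+1%:R + 6) * (2 * i.+1%:R + 15)) <=
    (i%:R + 6) * (2 * i%:R + 15) :> R by lra.
  by move=> i; rewrite -natr1; have : 0 <= i%:R :> R by []; nra.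
- by rewrite expr1n dE; lra.
- have := @geometric_decay R (1 / 10) (fun i => (i%:R + 6) ^+ 2) 5 k.
  rewrite dE1 dE !add0r => H.
  have {}H := H ltac:(lra) _.
  suff /H : forall i, 1 / 10 * (i.+1%:R + 6) ^+ 2 <= (i%:R + 6) ^+ 2 :> R by lra.
  move=> i; rewrite -[i.+1%:R]natr1; have : 0 <= i%:R :> R by [].
  by have := sqr_ge0 (i%:R : R); lra.
- by rewrite dE; lra.
Qed.

Lemma profile_uniformly_cauchy (R : realFieldType) d : (3 <= d)%N -> uniformly_cauchy R d.
Proof.
case: d => [|[|[|[|[|[|k]]]]]] // _.
- exact: (certificate_uniformly_cauchy R (d := 3) isT certificate3).
- exact: (certificate_uniformly_cauchy R (d := 4) isT certificate4).
- exact: (certificate_uniformly_cauchy R (d := 5) isT certificate5).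
rewrite -[X in uniformly_cauchy R X]/(6 + k)%N addnC; have ctr := contracting_large R k.
(* Here the profile is pinned from the start, so no initial moves are skipped. *)
have [|||C hC] := profile_cauchy (N := 0) ctr; [lra | lra | |].
  2: by exists 0%N, C, (4 / 5); split; [lra | lra |].
move=> n _; have cf := cutoff_profile R (k + 6) n.
have [f01 fni] := cf; have f1 := profile1_le_tenth R k n.
have : profile R (k + 6) n 2 <= profile R (k + 6) n 1 by apply: fni.
by have := f01 0; have := f01 (- 1); split=> //; lra.
Qed.

Local Open Scope classical_set_scope.

(** * Independence of events depending on disjoint sets of signs *)

Definition depends_on (I : eqType) (s : seq I) (phi : (I -> bool) -> bool) : Prop :=
  forall b b' : I -> bool, {in s, b =1 b'} -> phi b = phi b'.

Definition set_bit (I : eqType) (b : I -> bool) (i : I) (c : bool) : I -> bool :=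
  fun j => if j == i then c else b j.

(* The average of [phi] over the bits indexed by [s], the others being [false]. *)
Fixpoint bit_mean (R : realType) (I : eqType) (s : seq I) (phi : (I -> bool) -> bool) : R :=
  if s is i :: s' then
    (bit_mean R s' (fun b => phi (set_bit b i true)) +
     bit_mean R s' (fun b => phi (set_bit b i false))) / 2
  else (phi (fun=> false))%:R.

Lemma depends_on_set_bit (I : eqType) (i : I) s phi c :
  depends_on (i :: s) phi -> depends_on s (fun b => phi (set_bit b i c)).
Proof.
move=> dep b b' bb'; apply: dep => j; rewrite inE /set_bit.
by case: eqP => //= _; exact: bb'.
Qed.

Lemma depends_on_sub (I : eqType) (s s' : seq I) phi :
  {subset s <= s'} -> depends_on s phi -> depends_on s' phi.
Proof. by move=> ss' dep b b' bb'; apply: dep => i /ss'; exact: bb'. Qed.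

Lemma unzip1_inj (I : eqType) (A : eqType) (s : seq (I * A)) i c c' :
  uniq (unzip1 s) -> (i, c) \in s -> (i, c') \in s -> c = c'.
Proof.
elim: s => //= -[j a] s IH /andP[js us]; rewrite !inE.
have nin b : (i, b) \in s -> i = j -> False.
  by move=> ibs ij; move/negP: js; apply; apply/mapP; exists (i, b).
move=> /orP[/eqP[ij ->]|ics] /orP[/eqP[ij' ->]|ics'] //; last exact: IH.
  by have := nin _ ics' ij.
by have := nin _ ics ij'.
Qed.

Section signs.
Context disp (T : measurableType disp) (R : realType) (P : probability T R).
Context (I : choiceType) (X : I -> {RV P >-> R}).

(** Every value other than 1 is read as -1; by [negligible_not_sign] this errs only on a null
    set. *)
Definition sign_bit (w : T) (i : I) : bool := X i w == 1.

Definition event (phi : (I -> bool) -> bool) : set T := [set w | phi (sign_bit w)].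

Definition cylinder (t : seq (I * bool)) : (I -> bool) -> bool :=
  fun b => all (fun u => b u.1 == u.2) t.

Lemma measurable_sign_bit i c : measurable (event (fun b => b i == c)).
Proof.
have m1 : measurable (X i @^-1` [set 1]) by exact: measurable_funPTI.
have -> : event (fun b => b i == c) = if c then X i @^-1` [set 1] else ~` (X i @^-1` [set 1]).
  apply/seteqP; case: c; split=> w; rewrite /event /sign_bit /=.
  - by move/eqP/eqP.
  - by move=> ->; rewrite eqxx.
  - by move/eqP/negbT/eqP.
  - by move/eqP/negbTE ->.
by case: c => //; exact: measurableC.
Qed.

Lemma event_and phi psi : event (fun b => phi b && psi b) = event phi `&` event psi.
Proof. by apply/seteqP; split=> w; rewrite /event /= => /andP. Qed.

(** After the split, [phi] no longer looks at bit [i]; this drives the inductions on the list of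
    coordinates. *)
Lemma event_split phi i :
  event phi = (event (fun b => phi (set_bit b i true)) `&` event (fun b => b i == true)) `|`
              (event (fun b => phi (set_bit b i false)) `&` event (fun b => b i == false)).
Proof.
have E b c : b i = c -> set_bit b i c = b.
  by move=> <-; apply/funext => j; rewrite /set_bit; case: eqP => // ->.
apply/seteqP; split=> w; rewrite /event /=.
  by move=> phiw; case bi: (sign_bit w i); [left|right]; rewrite E.
by case=> -[phiw /eqP bi]; rewrite E in phiw.
Qed.

Lemma event_const phi : depends_on [::] phi ->
  event phi = if phi (fun=> false) then setT else set0.
Proof.
move=> dep; have E w : phi (sign_bit w) = phi (fun=> false) by exact: dep.
by apply/seteqP; split=> w; rewrite /event /= E; case: (phi _).
Qed.

Lemma measurable_event s phi : depends_on s phi -> measurable (event phi).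
Proof.
elim: s phi => [|i s IH] phi dep.
  rewrite (event_const dep).
  by case: ifP.
rewrite (event_split phi i); apply: measurableU; apply: measurableI;
  by [apply: IH; exact: depends_on_set_bit | exact: measurable_sign_bit].
Qed.

Lemma cylinder_depends_on t : depends_on (unzip1 t) (cylinder t).
Proof.
move=> b b' bb'; rewrite /cylinder; apply: eq_in_all => u ut.
by rewrite bb'//; apply/mapP; exists u.
Qed.

Definition prob (A : set T) : R := fine (P A).

Lemma probE A : measurable A -> P A = (prob A)%:E.
Proof. by move=> mA; rewrite fineK// fin_num_measure. Qed.

Lemma prob_setT : prob setT = 1.
Proof. by rewrite /prob probability_setT. Qed.

Lemma probU A B : measurable A -> measurable B -> A `&` B = set0 ->
  prob (A `|` B) = prob A + prob B.
Proof.
move=> mA mB AB; apply: EFin_inj; rewrite EFinD -!probE//; last exact: measurableU.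
by rewrite measureU.
Qed.

Context (hX : iid_uniform_signs X).

Lemma prob_cylinder t : uniq (unzip1 t) -> prob (event (cylinder t)) = 2^-1 ^+ size t.
Proof.
(* The bit [false] corresponds to the complement of {1}, also of probability 1/2, rather than to
   {-1}; this matches [sign_bit] exactly. *)
move=> ut; pose B i : set R := if (i, true) \in t then [set 1] else ~` [set 1].
have mB i : measurable (B i) by rewrite /B; case: ifP => // _; exact: measurableC.
have half c i : P (X i @^-1` (if c then [set 1] else ~` [set 1])) = (2^-1)%:E.
  have [P1 _] := hX.2 i; case: c; first exact: P1.
  rewrite -preimage_setC probability_setC ?P1; last exact: measurable_funPTI.
  by rewrite -EFinB; congr EFin; field.
have -> : event (cylinder t) = \bigcap_(i in [set` unzip1 t]) X i @^-1` B i.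
  apply/seteqP; split=> w; rewrite /event /cylinder /sign_bit /=.
    move=> /allP h i /= it; rewrite /B; case: ifPn => [/h /= /eqP/eqP //|itt].
    have /mapP[[i' c] ict /= ii'] := it; subst i.
    case: c ict => ict; first by rewrite ict in itt.
    by move/h : ict => /= /eqP/negbT/eqP.
  move=> h; apply/allP => -[i c] ict /=.
  have /h : i \in unzip1 t by apply/mapP; exists (i, c).
  rewrite /= /B; case: ifPn => [itt -> |itt Xi].
    by rewrite (unzip1_inj ut ict itt) eqxx.
  by case: c ict => [/[dup] ict|_]; [rewrite (negbTE itt) in ict | apply/eqP/negbTE/eqP].
rewrite /prob hX.1//.
have -> : (\prod_(i <- unzip1 t) P (X i @^-1` B i) = (2^-1 ^+ size t)%:E)%E.
  rewrite -(size_map fst) -/(unzip1 t); elim: (unzip1 t) => [|i s IH].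
    by rewrite big_nil.
  rewrite big_cons IH /B exprS EFinM; congr (_ * _)%E.
  by have := half ((i, true) \in t) i; case: ifP.
by [].
Qed.

(* With [A := setT] this computes the probability of an event; with [A] an event
   on other signs it gives independence. *)
Lemma prob_event_cylinder (D : pred I) (A : set T) : measurable A ->
  (forall t, uniq (unzip1 t) -> all D (unzip1 t) ->
     prob (A `&` event (cylinder t)) = prob A * 2^-1 ^+ size t) ->
  forall s phi t, depends_on s phi -> uniq (s ++ unzip1 t) -> all D (s ++ unzip1 t) ->
    prob (A `&` event phi `&` event (cylinder t)) =
    prob A * bit_mean R s phi * 2^-1 ^+ size t.
Proof.
move=> mA HA; elim=> [|i s IH] phi t dep /= ut Dt.
  rewrite (event_const dep).
  case: ifP => _; first by rewrite setIT HA// mulr1.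
  by rewrite setI0 set0I /prob measure0 mulr0 mul0r.
have C c : prob (A `&` event (fun b => phi (set_bit b i c)) `&` event (fun b => b i == c) `&`
      event (cylinder t)) =
    prob A * bit_mean R s (fun b => phi (set_bit b i c)) * 2^-1 ^+ (size t).+1.
  (* The bit just fixed moves from the list of [phi] into the cylinder. *)
  rewrite -(IH _ ((i, c) :: t)); first last.
  - by move: Dt; rewrite !all_cat /= => /and3P[-> -> ->].
  - by rewrite uniq_catC /= uniq_catC mem_cat orbC -mem_cat.
  - exact: depends_on_set_bit.
  by rewrite -setIA -event_and.
have mp c : measurable (event (fun b => phi (set_bit b i c))).
  by apply: (@measurable_event s); exact: depends_on_set_bit.
have mt : measurable (event (cylinder t)).
  by apply: (@measurable_event (unzip1 t)); exact: cylinder_depends_on.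
rewrite {1}(event_split phi i) setIUr setIUl probU ?setIA ?C.
- by rewrite exprS; field.
- by do 3?apply: measurableI => //; exact: measurable_sign_bit.
- by do 3?apply: measurableI => //; exact: measurable_sign_bit.
- by apply/seteqP; split=> // w [[[[[[_ /eqP h] _] _] _] /eqP]]; rewrite h.
Qed.

Lemma prob_event s phi : uniq s -> depends_on s phi -> prob (event phi) = bit_mean R s phi.
Proof.
move=> us dep.
have := @prob_event_cylinder predT setT measurableT _ s phi [::] dep.
rewrite cats0 all_predT expr0 mulr1 prob_setT mul1r => <- //.
  by rewrite setTI (_ : event (cylinder [::]) = setT) ?setIT//; apply/seteqP.
by move=> t ut _; rewrite setTI prob_cylinder// mul1r.
Qed.

(** [prob_event_cylinder] serves twice: with the sure event it makes [event phi] independent of the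
    cylinders off [s], and with [A := event phi] it passes from these cylinders to [psi]. *)
Lemma prob_event_and s s' phi psi : depends_on s phi -> depends_on s' psi ->
  (forall i, i \in s -> i \in s' -> False) ->
  prob (event (fun b => phi b && psi b)) = prob (event phi) * prob (event psi).
Proof.
move=> dphi dpsi ss'.
have {}dphi : depends_on (undup s) phi by apply: depends_on_sub dphi => i; rewrite mem_undup.
have {}dpsi : depends_on (undup s') psi by apply: depends_on_sub dpsi => i; rewrite mem_undup.
have mphi := measurable_event dphi.
have := @prob_event_cylinder (fun i => i \notin s) (event phi) mphi _ (undup s') psi [::] dpsi.
rewrite cats0 expr0 mulr1 -(prob_event _ dpsi) ?undup_uniq// event_and => <- //.
- by rewrite (_ : event (cylinder [::]) = setT) ?setIT//; apply/seteqP.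
- move=> t ut /allP tD.
  have := @prob_event_cylinder predT setT measurableT _ (undup s) phi t dphi.
  rewrite all_predT prob_setT mul1r setTI => -> //.
  + by rewrite -(prob_event _ dphi) ?undup_uniq.
  + by move=> t' ut' _; rewrite setTI prob_cylinder// mul1r.
  + rewrite cat_uniq undup_uniq ut /= andbT; apply/hasPn => i /tD.
    by rewrite mem_undup.
- by apply/allP => i; rewrite mem_undup => is'; apply/negP => /ss'; exact.
Qed.

End signs.

(** * The distribution of the value of the game *)

Section sign_events.
Context disp (T : measurableType disp) (R : realType) (P : probability T R).
Context (I : choiceType) (X : I -> {RV P >-> R}) (hX : iid_uniform_signs X).

Lemma depends_on_not (s : seq I) phi :
  depends_on s phi -> depends_on s (fun b => ~~ phi b).
Proof. by move=> dep b b' /dep ->. Qed.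

Lemma prob_event_not s phi : depends_on s phi ->
  prob P (event X (fun b => ~~ phi b)) = 1 - prob P (event X phi).
Proof.
move=> dep; have mphi := measurable_event X dep.
have -> : event X (fun b => ~~ phi b) = ~` event X phi.
  by apply/seteqP; split=> w /negP.
by rewrite /prob probability_setC// probE.
Qed.

Lemma depends_on_bit (i : I) (f : bool -> bool) : depends_on [:: i] (fun b => f (b i)).
Proof. by move=> b b' ->//; rewrite inE. Qed.

Lemma prob_bit i : prob P (event X (fun b => b i)) = 2^-1.
Proof.
have di : depends_on [:: i] (fun b => b i) := @depends_on_bit i id.
rewrite (prob_event hX _ di)//=.
by rewrite /set_bit eqxx addr0 mul1r.
Qed.

Lemma depends_on_if (s s' : seq I) i phi psi : depends_on s phi -> depends_on s' psi ->
  depends_on (i :: s ++ s') (fun b => if b i then phi b else psi b).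
Proof.
move=> dphi dpsi b b' bb'.
rewrite (dphi b b') ?(dpsi b b') ?(bb' i) ?mem_head// => j js; apply: bb';
  by rewrite inE mem_cat js !orbT.
Qed.

(** Conditioning on the fair bit [i]. The lists [s] and [s'] may overlap: each event only has to be
    independent of that bit. *)
Lemma prob_event_if (s s' : seq I) i phi psi : depends_on s phi -> depends_on s' psi ->
  i \notin s -> i \notin s' ->
  prob P (event X (fun b => if b i then phi b else psi b)) =
  (prob P (event X phi) + prob P (event X psi)) / 2.
Proof.
move=> dphi dpsi si si'.
have dN : depends_on [:: i] (fun b => ~~ b i) := @depends_on_bit i negb.
have di : depends_on [:: i] (fun b => b i) := @depends_on_bit i id.
have -> : event X (fun b => if b i then phi b else psi b) =
    event X (fun b => b i && phi b) `|` event X (fun b => ~~ b i && psi b).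
  apply/seteqP; split=> w; rewrite /event /=; case: (sign_bit _ _ _) => /= h;
    by [left | right | case: h].
rewrite probU.
- rewrite (prob_event_and hX di dphi); last by move=> j; rewrite inE => /eqP -> /(negP si).
  rewrite (prob_event_and hX dN dpsi); last by move=> j; rewrite inE => /eqP -> /(negP si').
  by rewrite (prob_event_not di) prob_bit; field.
- rewrite event_and; apply: measurableI; apply: measurable_event; eassumption.
- rewrite event_and; apply: measurableI; apply: measurable_event; eassumption.
- by apply/seteqP; split=> // w []; rewrite /event /=; case: (sign_bit _ _ _).
Qed.

Lemma depends_on_all (J : eqType) (l : seq J) (s : J -> seq I) phi :
  (forall j, depends_on (s j) (phi j)) ->
  depends_on (flatten (map s l)) (fun b => all (phi^~ b) l).
Proof.
move=> dep b b' bb'; apply: eq_in_all => j jl; apply: dep => i ij; apply: bb'.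
by apply/flattenP; exists (s j) => //; exact: map_f.
Qed.

Lemma prob_event_all (J : eqType) (l : seq J) (s : J -> seq I) phi :
  (forall j, depends_on (s j) (phi j)) ->
  (forall j k i, j != k -> i \in s j -> i \in s k -> False) -> uniq l ->
  prob P (event X (fun b => all (phi^~ b) l)) = \prod_(j <- l) prob P (event X (phi j)).
Proof.
move=> dep disj; elim: l => [|j l IH] /=.
  move=> _; rewrite big_nil (_ : event X _ = setT) ?prob_setT//.
  by apply/seteqP; split.
move=> /andP[jl ul]; rewrite big_cons -IH//.
apply: (prob_event_and hX (dep j) (depends_on_all dep)) => i ij /flattenP[_ /mapP[k kl ->]].
by apply: disj ij; apply: contraNneq jl => ->.
Qed.

End sign_events.

(* [b e] tells whether the cookie on [e] is +1; [win b k v j] says that (-1)^|v|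
   times the value of [v] with [k] moves left is at least 2j.  For an integer
   y one has 2j <= xi - y iff not 2j' <= y, where j' is 1 - j for xi = 1 and - j
   for xi = -1. *)
Fixpoint win (d : nat) (b : edge d -> bool) (k : nat) (v : vertex d) (j : int) : bool :=
  if k is k'.+1 then
    ~~ all (fun i => win b k' (child v i) (if b (v, i) (+) odd (height v) then 1 - j else - j))
      (enum 'I_d)
  else j <= 0.

Fixpoint edges_below (d : nat) (k : nat) (v : vertex d) : seq (edge d) :=
  if k is k'.+1 then
    flatten [seq (v, i) :: edges_below k' (child v i) | i <- enum 'I_d]
  else [::].

Lemma edges_below_prefix d k (v : vertex d) e : e \in edges_below k v -> prefix v e.1.
Proof.
elim: k v => //= k IH v /flattenP[_ /mapP[i _ ->]].
rewrite inE => /orP[/eqP -> |/IH]; first exact: prefix_refl.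
by apply: prefix_trans; exact: prefix_rcons.
Qed.

Lemma win_depends_on d k (v : vertex d) j :
  depends_on (edges_below k v) (fun b => win b k v j).
Proof.
elim: k v j => // k IH v j b b' bb' /=; congr (~~ _); apply: eq_in_all => i _.
have bb'i e : e \in (v, i) :: edges_below k (child v i) -> b e = b' e.
  move=> ei; apply: bb' => /=; apply/flattenP.
  exists ((v, i) :: edges_below k (child v i)) => //.
  by apply/mapP; exists i => //; rewrite mem_enum.
rewrite (bb'i (v, i)) ?mem_head//; apply: IH => e ei; apply: bb'i.
by rewrite inE ei orbT.
Qed.

Lemma child_notin_edges_below d k (v : vertex d) i : (v, i) \notin edges_below k (child v i).
Proof.
by apply/negP => /edges_below_prefix /= /size_prefix; rewrite size_rcons ltnn.
Qed.

(** The prefix of length |v| + 1 of a descendant tells through which child of [v] it is reached. *)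
Lemma edges_below_disjoint d k (v : vertex d) i j e : i != j ->
  e \in (v, i) :: edges_below k (child v i) ->
  e \in (v, j) :: edges_below k (child v j) -> False.
Proof.
move=> ij; rewrite !inE => /orP[/eqP ->|/edges_below_prefix ei].
  case/orP => [/eqP[] /eqP|/edges_below_prefix /= /size_prefix]; first by rewrite (negbTE ij).
  by rewrite size_rcons ltnn.
case/orP => [/eqP ee|/edges_below_prefix ej].
  by move: ei; rewrite ee => /size_prefix; rewrite size_rcons ltnn.
move: ei ej; rewrite !prefixE !size_rcons => /eqP -> /eqP /rcons_inj[] /eqP.
by rewrite (negbTE ij).
Qed.

Section game.
Context disp (T : measurableType disp) (R : realType) (P : probability T R) (d : nat).
Context (X : edge d -> {RV P >-> R}) (hX : iid_uniform_signs X).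

(** The branches through different children use disjoint edges, and each cookie is independent of
    the subtree below it. The parity of the height merely swaps the two equally likely signs. *)
Lemma prob_win k v j : prob P (event X (fun b => win b k v j)) = profile R d k j.
Proof.
elim: k v j => [|k IH] v j /=.
  have -> : event X (fun b => (j <= 0)%R) = if (j <= 0)%R then setT else set0.
    by apply/seteqP; split=> w; rewrite /event /=; case: ifP.
  by case: ifP => _; rewrite ?prob_setT// /prob measure0.
pose phi i (b : edge d -> bool) :=
  win b k (child v i) (if b (v, i) (+) odd (height v) then 1 - j else - j).
pose s i := (v, i) :: edges_below k (child v i).
have dphi i : depends_on (s i) (phi i).
  rewrite /phi => b b' bb'; rewrite (bb' (v, i)) ?mem_head//; apply: win_depends_on => e ei.
  by apply: bb'; rewrite inE ei orbT.
rewrite (prob_event_not X (depends_on_all dphi)) (prob_event_all hX dphi); last first.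
- exact: enum_uniq.
- by move=> i i' e; exact: edges_below_disjoint.
have dw (u : vertex d) j' : depends_on (edges_below k u) (fun b => win b k u j').
  exact: win_depends_on.
have E i : prob P (event X (phi i)) = (profile R d k (- j) + profile R d k (1 - j)) / 2.
  have -> : phi i = fun b => if b (v, i)
      then win b k (child v i) (if ~~ odd (height v) then 1 - j else - j)
      else win b k (child v i) (if odd (height v) then 1 - j else - j).
    by apply/funext => b; rewrite /phi; case: (b _); case: odd.
  rewrite (prob_event_if hX (dw _ _) (dw _ _));
    rewrite ?child_notin_edges_below// !IH.
  by case: odd => /=; field.
rewrite /half_round; under eq_bigr do rewrite E.
by rewrite big_enum /= prodr_const card_ord.
Qed.

End game.

(** The sign turns the minimum at odd vertices into a maximum, and a child has the opposite sign.
    The maximum is expressed as an attained upper bound. *)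
Lemma signed_value_step (R : realType) d (x : edge d -> R) k v
    (V := fun k v => (-1) ^+ height v * value_rec x k v)
    (y := fun i => (-1) ^+ height v * x (v, i) - V k (child v i)) : (0 < d)%N ->
  (exists i, V k.+1 v = y i) /\ (forall i, y i <= V k.+1 v).
Proof.
move=> d0; set s := [seq x (v, i) + value_rec x k (child v i) | i <- enum 'I_d].
(* Nonemptiness excludes the default value 0 of [seq_max] and [seq_min]. *)
have s0 : s != [::] by rewrite -size_eq0 size_map size_enum_ord -lt0n.
have yE i : y i = (-1) ^+ height v * (x (v, i) + value_rec x k (child v i)).
  by rewrite /y /V /child /height size_rcons exprS mulrDr mulN1r mulNr opprK.
have VE : V k.+1 v = (-1) ^+ height v * (if odd (height v) then seq_min s else seq_max s).
  by rewrite /V /=; case: (odd _).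
rewrite VE; rewrite -signr_odd in yE *.
case: (odd _) yE => yE; rewrite ?expr1 ?expr0 ?mulN1r ?mul1r.
- have [/mapP[i _ sE] smin] := seq_minP s0; split=> [|j]; first by exists i; rewrite yE sE mulN1r.
  by rewrite yE mulN1r lerN2; apply: smin; apply: map_f; rewrite mem_enum.
- have [/mapP[i _ sE] smax] := seq_maxP s0; split=> [|j]; first by exists i; rewrite yE sE mul1r.
  by rewrite yE mul1r; apply: smax; apply: map_f; rewrite mem_enum.
Qed.

(** A sum of [k] signs has the parity of [k], whence the form [2 * z + k]. *)
Lemma value_win (R : realType) d (x : edge d -> R) (b : edge d -> bool) k v : (0 < d)%N ->
  {in edges_below k v, forall e, x e = if b e then 1 else -1} ->
  exists z : int, (-1) ^+ height v * value_rec x k v = (2 * z + k%:Z)%:~R /\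
    forall j, win b k v j = (2 * j <= 2 * z + k%:Z).
Proof.
move=> d0; elim: k v => [|k IH] v xb.
  by exists 0; split=> [|j] /=; [rewrite mulr0 | lia].
have /choice[z zP] : forall i, exists z : int,
    (-1) ^+ height (child v i) * value_rec x k (child v i) = (2 * z + k%:Z)%:~R /\
    forall j, win b k (child v i) j = (2 * j <= 2 * z + k%:Z).
  move=> i; apply: IH => e ei; apply: xb; apply/flattenP => /=.
  exists ((v, i) :: edges_below k (child v i)); last by rewrite inE ei orbT.
  by apply/mapP; exists i; rewrite ?mem_enum.
(* [u i] solves 2 u + (k + 1) = s - (2 z + k), where s is the signed cookie; s = 1 exactly when the
   test holds. *)
pose u i : int := if b (v, i) (+) odd (height v) then - z i - k%:Z else - z i - k%:Z - 1.
have [[i0 V0] Vmax] := signed_value_step x k v d0.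
have yE i : (-1) ^+ height v * x (v, i) - (-1) ^+ height (child v i) * value_rec x k (child v i) =
    (2 * u i + k.+1%:Z)%:~R :> R.
  have -> : 2 * u i + k.+1%:Z = (if b (v, i) (+) odd (height v) then 1 else - 1) - (2 * z i + k%:Z).
    by rewrite /u; case: ifP => _; lia.
  rewrite intrB (zP i).1 -signr_odd xb; last first.
    apply/flattenP => /=; exists ((v, i) :: edges_below k (child v i)).
      by apply/mapP; exists i; rewrite ?mem_enum.
    exact: mem_head.
  by case: (b _); case: (odd _) => /=; rewrite ?expr1 ?expr0 ?mulN1r ?mul1r ?opprK.
have umax i : u i <= u i0.
  by have := Vmax i; rewrite V0 !yE ler_int; lia.
exists (u i0); split; first by rewrite V0 yE.
move=> j /=; rewrite -has_predC; apply/hasP/idP => [[i _ /=]|jV].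
  by rewrite (zP i).2; have := umax i; rewrite /u; case: (b _ (+) _); case: (b _ (+) _); lia.
exists i0; rewrite ?mem_enum//= (zP i0).2; move: jV; rewrite /u; case: (b _ (+) _); lia.
Qed.

Section game_cdf.
Context disp (T : measurableType disp) (R : realType) (P : probability T R) (d : nat).
Context (X : edge d -> {RV P >-> R}) (hX : iid_uniform_signs X).

(** The probabilities of 1 and -1 add up to 1, so each variable takes other values only on a null
    set; finitely many null sets are united. *)
Lemma negligible_not_sign (s : seq (edge d)) :
  P.-negligible (~` [set w | {in s, forall e, X e w = if sign_bit X w e then 1 else -1}]).
Proof.
have null e : P.-negligible (~` [set w | X e w = if sign_bit X w e then 1 else -1]).
  have m1 c : measurable (X e @^-1` [set c]) by exact: measurable_funPTI.
  have -> : ~` [set w | X e w = if sign_bit X w e then 1 else -1] =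
      ~` (X e @^-1` [set 1] `|` X e @^-1` [set -1]).
    congr (~` _); apply/seteqP; split=> w; rewrite /sign_bit /=.
      by case: eqP; [left|right].
    by case=> ->; rewrite ?eqxx//; case: eqP.
  apply/negligibleP; first by apply: measurableC; exact: measurableU.
  apply: etrans (probability_setC P (measurableU _ _ (m1 1) (m1 (-1)))) _.
  have [P1 PN1] := hX.2 e; rewrite measureU//.
    rewrite [X in (_ - (X + _))%E]P1 [X in (_ - (_ + X))%E]PN1 -EFinD.
    have -> : 2^-1 + 2^-1 = 1 :> R by field.
    by rewrite subrr.
  by apply/seteqP; split=> // w [] /= ->; lra.
elim: s => [|e s IH].
  rewrite (_ : ~` _ = set0); first exact: negligible_set0.
  by apply/seteqP; split=> // w; apply => e; rewrite in_nil.
apply: negligibleS (negligibleU (null e) IH) => w /= h.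
case: (pselect (X e w = if sign_bit X w e then 1 else -1)) => [Xe|]; last by left.
right=> hs; apply: h => e'; rewrite inE => /orP[/eqP -> //|]; exact: hs.
Qed.

(** Almost surely the value at the root is even, and [Num.floor (r / 2) + 1] is the least integer j
    with 2j > r; thus the value is at most [r] iff it is not at least 2j. *)
Lemma cdf_game_value n r : (0 < d)%N ->
  cdf (game_value X n) r = (1 - profile R d (2 * n) (Num.floor (r / 2) + 1))%:E.
Proof.
move=> d0; set j := Num.floor (r / 2) + 1.
have dep : depends_on (edges_below (2 * n) (root_vertex d))
    (fun b => win b (2 * n) (root_vertex d) j) by exact: win_depends_on.
rewrite -(prob_win hX (2 * n) (root_vertex d) j) -(prob_event_not X dep).
rewrite -probE; last by apply: measurable_event; apply: depends_on_not; exact: dep.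
set G := [set w | {in edges_below (2 * n) (root_vertex d),
  forall e, X e w = if sign_bit X w e then 1 else -1}].
have [N [mN N0 GN]] := negligible_not_sign (edges_below (2 * n) (root_vertex d)).
set A := (X in P X = _); set B := (X in _ = P X).
have mA : measurable A by exact: measurable_funPTI.
have mB : measurable B by apply: measurable_event; apply: depends_on_not; exact: dep.
have AB w : ~ N w -> (A w <-> B w).
  move=> Nw; have {GN} Gw : G w by apply: contrapT => /GN.
  have [z [Vz winz]] := value_win d0 Gw.
  rewrite /A /B /event /= winz in_itv /= /game_value /= /random_value /value /height /= subn0.
  move: Vz; rewrite /height expr0 mul1r => ->.
  rewrite (_ : 2 * z + (2 * n)%N = 2 * (z + n%:Z)); last by lia.
  rewrite intrM (_ : (2 * (z + n%:Z)%:~R <= r) = ((z + n%:Z)%:~R <= r / 2)); last first.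
    by apply/idP/idP; lra.
  by rewrite -floor_ge_int /j; move: (Num.floor _) => m; clear; split; lia.
have AN : A `|` N = B `|` N.
  apply/seteqP; split=> w; case: (pselect (N w)) => [|/AB Aw []];
    by [right | move/Aw; left |].
by rewrite -(measureU0 mA mN N0) -(measureU0 mB mN N0) AN.
Qed.

End game_cdf.

(** * The limit law *)

Lemma profile_uniform_cvg (R : realType) d : (3 <= d)%N -> exists L : int -> R,
  (forall j, profile R d n j @[n --> \oo] --> L j) /\
  forall eps, 0 < eps -> exists n, forall j, `|L j - profile R d n j| <= eps.
Proof.
move=> d3; have [N [C [lam [lam0 lam1 cau]]]] := profile_uniformly_cauchy R d3.
have small eps : 0 < eps -> exists k, C * lam ^+ k < eps.
  move=> eps0; have lamN : `|lam| < 1 by rewrite ger0_norm.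
  have /cvgrPdist_lt/(_ _ eps0) : C * lam ^+ n @[n --> \oo] --> C * 0.
    by apply: cvgM; [exact: cvg_cst | exact: cvg_expr].
  rewrite mulr0 => -[k _ /(_ k (leqnn k)) /=]; rewrite sub0r normrN => h.
  by exists k; apply: le_lt_trans h; exact: ler_norm.
have cv j : cvgn (profile R d ^~ j).
  apply/cauchy_cvgP/cauchy_exP => eps eps0; have [k hk] := small eps eps0.
  exists (profile R d (N + k) j); exists (N + k)%N => // n /= Nkn.
  rewrite /ball /= distrC; apply: le_lt_trans hk.
  by rewrite -(subnKC Nkn).
exists (fun j => lim (profile R d n j @[n --> \oo])); split=> [j|eps eps0]; first exact: cv.
have [k hk] := small eps eps0; exists (N + k)%N => j.
(* Letting the later index tend to infinity in the Cauchy bound keeps it uniform in [j]. *)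
have h : `|profile R d n j - profile R d (N + k) j| @[n --> \oo] -->
    `|lim (profile R d n j @[n --> \oo]) - profile R d (N + k) j|.
  by apply: cvg_norm; apply: cvgB; [exact: cv | exact: cvg_cst].
rewrite -(cvg_lim _ h)//; apply: limr_le; first by apply/cvg_ex; eexists; exact: h.
exists (N + k)%N => // n /= Nkn; apply: le_trans (ltW hk).
by rewrite -(subnKC Nkn).
Qed.

(** The law is the Lebesgue-Stieltjes measure of a step function [F], the distribution function of
    half of [Z]. The tail hypothesis gives [F] the limits 0 and 1, so no mass escapes. *)
Lemma integer_law (R : realType) (L : int -> R) :
  (forall i j, i <= j -> L j <= L i) ->
  (forall eps, 0 < eps -> exists n : nat,
     (forall j, n%:Z <= j -> `|L j| <= eps) /\ (forall j, j <= - n%:Z -> `|1 - L j| <= eps)) ->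
  exists (disp : measure_display) (T : measurableType disp) (P : probability T R)
      (Z : {RV P >-> R}),
    (forall w, Z w \is a Num.int) /\
    forall r, cdf Z r = (1 - L (Num.floor (r / 2) + 1))%:E.
Proof.
move=> Lni Llim; pose F (y : R) : R := 1 - L (Num.floor y + 1).
have Fnd : nondecreasing F.
  by move=> x y xy; rewrite /F lerD2l lerN2 Lni// lerD2r le_floor.
have Frc : right_continuous F.
  (* Just to the right of [x] the floor does not change. *)
  move=> x; apply: cvg_near_cst; near=> y.
  rewrite /F (_ : Num.floor y = Num.floor x)//; apply: floor_def; apply/andP; split.
    by apply: le_trans (floor_le_tmp _) _; near: y; exact: nbhs_right_ge.
  by near: y; apply: nbhs_right_lt; exact: floorD1_gt.
have FNy : F @ -oo --> (0 : R).
  apply/cvgrPdist_le => eps eps0; have [n [_ hn]] := Llim eps eps0.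
  near=> y; rewrite sub0r normrN; apply: hn.
  have : Num.floor y <= Num.floor ((- n%:Z - 1)%:~R : R).
    by apply: le_floor; near: y; exact: nbhs_ninfty_le.
  by rewrite intrKfloor; lia.
have Fy : F @ +oo --> (1 : R).
  apply/cvgrPdist_le => eps eps0; have [n [hn _]] := Llim eps eps0.
  near=> y; rewrite /F opprB addrC subrK; apply: hn.
  have : Num.floor (n%:Z%:~R : R) <= Num.floor y.
    by apply: le_floor; near: y; exact: nbhs_pinfty_ge.
  by rewrite intrKfloor; lia.
pose f : cumulativeBounded (0 : R) (1 : R) := HB.pack F
  (isCumulative.Build R _ R F Fnd Frc) (isCumulativeBounded.Build R 0 1 F FNy Fy).
pose P := lebesgue_stieltjes_measure f : probability _ R.
(* Rounding up makes [Z <= r] a closed half-line, whose measure is a value of F. *)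
pose Z (y : measurableTypeR R) : R := 2 * (Num.ceil y)%:~R.
have mZ : measurable_fun [set: measurableTypeR R] Z.
  apply: nondecreasing_measurable => // x y xy.
  by rewrite ler_wpM2l// ler_int le_ceil.
pose Z' : {RV P >-> R} := HB.pack Z (isMeasurableFun.Build _ _ _ _ Z mZ).
exists _, _, P, Z'; split=> [w|r].
  by rewrite /= /Z rpredM ?natr_int ?intr_int.
transitivity (F (Num.floor (r / 2))%:~R)%:E; last by rewrite /F intrKfloor.
rewrite -(cdf_lebesgue_stieltjes_id f).
rewrite /cdf /distribution /pushforward; congr (lebesgue_stieltjes_measure f _).
have E y : (Z y <= r) = (y <= (Num.floor (r / 2))%:~R).
  rewrite -ceil_le_int floor_ge_int /Z; apply/idP/idP; lra.
by apply/seteqP; split=> y; rewrite /= !in_itv /= E.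
Unshelve. all: by end_near. Qed.

Theorem theorem1p2 (R : realType) (d : nat) (hd : (3 <= d)%N)
    (disp : measure_display) (T : measurableType disp) (P : probability T R)
    (X : edge d -> {RV P >-> R}) (hX : iid_uniform_signs X) :
  exists (disp' : measure_display) (T' : measurableType disp')
      (P' : probability T' R) (Z : {RV P' >-> R}),
    (forall w : T', Z w \is a Num.int) /\
    cvg_in_distribution (game_value X) Z.
Proof.
have d0 : (0 < d)%N by lia.
have [L [pL unif]] := profile_uniform_cvg R hd.
have [||disp' [T' [P' [Z [Zint ZL]]]]] := @integer_law R L.
- move=> i j ij; rewrite -(cvg_lim _ (pL i))// -(cvg_lim _ (pL j))//.
  apply: ler_lim; [by apply/cvg_ex; exists (L j) | by apply/cvg_ex; exists (L i) |].
  by apply: nearW => n; apply: (cutoff_profile R d n).2.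
(* The shift to [n.+1] is due to the profile vanishing strictly above [n]. *)
- move=> eps /unif[n hn]; exists n.+1; split=> j nj; have := hn j;
    have [p0 p1] := profile_support R n j d0.
    by rewrite p0 ?subr0//; clear -nj; lia.
  by rewrite p1 1?distrC//; clear -nj; lia.
exists disp', T', P', Z; split=> // r _; rewrite ZL.
under eq_fun do rewrite (cdf_game_value hX)//.
apply: cvg_EFin; first exact: nearW.
apply: cvgB; first exact: cvg_cst.
(* A game of [n] rounds has [2 * n] moves, so only the profiles of even index enter. *)
exact: (cvg_comp _ _ (@cvg_mulnl 2 isT) (pL _)).
Qed.
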